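(* Let $G_1,G_2$ be Polish groups and let $A_1\subseteq G_1$ and $A_2\subseteq G_2$ be analytic sets. Then the following are equivalent: (i) $A_1$ is not Haar meager in $G_1$ and $A_2$ is not Haar meager in $G_2$; (ii) $A_1\times A_2$ is not Haar meager in the product group $G_1\times G_2$.
   Context: Let $G$ be a Polish group. A set $A\subseteq G$ is called Haar meager if there exist a Borel set $B\subseteq G$ with $A\subseteq B$, a compact metric space $K$, and a continuous map $f\colon K\to G$ such that $f^{-1}(gBh)$ is meager in $K$ for every $g,h\in G$. *)

(* Defs.v *)
From Stdlib Require Import Reals List.
Open Scope R_scope.
Set Implicit Arguments.

Definition is_metric {X : Type} (d : X -> X -> R) : Prop :=
  (forall x y, 0 <= d x y) /\
  (forall x y, d x y = 0 <-> x = y) /\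
  (forall x y, d x y = d y x) /\
  (forall x y z, d x z <= d x y + d y z).

Definition metric_open {X : Type} (d : X -> X -> R) (U : X -> Prop) : Prop :=
  forall x, U x -> exists eps, 0 < eps /\ forall y, d x y < eps -> U y.

Definition cauchy_complete {X : Type} (d : X -> X -> R) : Prop :=
  forall u : nat -> X,
    (forall eps, 0 < eps -> exists N, forall m n, (N <= m)%nat -> (N <= n)%nat ->
        d (u m) (u n) < eps) ->
    exists x, forall eps, 0 < eps -> exists N, forall n, (N <= n)%nat -> d (u n) x < eps.

(** * Topological notions (a topology on X is given by its family of open sets) *)
Definition countable_set {X : Type} (D : X -> Prop) : Prop :=
  exists f : X -> nat, forall x y, D x -> D y -> f x = f y -> x = y.

Definition separable {X : Type} (op : (X -> Prop) -> Prop) : Prop :=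
  exists D : X -> Prop, countable_set D /\
    forall U, op U -> (exists x, U x) -> exists x, U x /\ D x.

Definition polish {X : Type} (op : (X -> Prop) -> Prop) : Prop :=
  (exists d : X -> X -> R, is_metric d /\ cauchy_complete d /\
     forall U, op U <-> metric_open d U) /\
  separable op.

Definition continuous {X Y : Type} (opX : (X -> Prop) -> Prop)
  (opY : (Y -> Prop) -> Prop) (f : X -> Y) : Prop :=
  forall V, opY V -> opX (fun x => V (f x)).

Definition prod_open {X Y : Type} (opX : (X -> Prop) -> Prop)
  (opY : (Y -> Prop) -> Prop) (W : X * Y -> Prop) : Prop :=
  forall p, W p -> exists U V, opX U /\ opY V /\ U (fst p) /\ V (snd p) /\
     forall a b, U a -> V b -> W (a, b).

Definition polish_group {G : Type} (op : (G -> Prop) -> Prop)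
  (mul : G -> G -> G) (inv : G -> G) (one : G) : Prop :=
  polish op /\
  (forall x y z, mul x (mul y z) = mul (mul x y) z) /\
  (forall x, mul one x = x /\ mul x one = x) /\
  (forall x, mul (inv x) x = one /\ mul x (inv x) = one) /\
  continuous (prod_open op op) op (fun p => mul (fst p) (snd p)) /\
  continuous op op inv.

Definition borel {X : Type} (op : (X -> Prop) -> Prop) (B : X -> Prop) : Prop :=
  forall S : (X -> Prop) -> Prop,
    (forall U, op U -> S U) ->
    (forall A, S A -> S (fun x => ~ A x)) ->
    (forall A : nat -> X -> Prop, (forall n, S (A n)) -> S (fun x => exists n, A n x)) ->
    S B.

Definition analytic {X : Type} (op : (X -> Prop) -> Prop) (A : X -> Prop) : Prop :=
  exists (Y : Type) (opY : (Y -> Prop) -> Prop) (f : Y -> X),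
    polish opY /\ continuous opY op f /\ forall x, A x <-> exists y, f y = x.

Definition compact {X : Type} (op : (X -> Prop) -> Prop) : Prop :=
  forall (I : Type) (U : I -> X -> Prop),
    (forall i, op (U i)) -> (forall x, exists i, U i x) ->
    exists l : list I, forall x, exists i, In i l /\ U i x.

Definition nowhere_dense {X : Type} (op : (X -> Prop) -> Prop) (N : X -> Prop) : Prop :=
  forall U, op U -> (exists x, U x) ->
    exists V, op V /\ (exists x, V x) /\ (forall x, V x -> U x) /\ (forall x, V x -> ~ N x).

Definition meager {X : Type} (op : (X -> Prop) -> Prop) (M : X -> Prop) : Prop :=
  exists N : nat -> X -> Prop, (forall n, nowhere_dense op (N n)) /\
    forall x, M x -> exists n, N n x.

Definition haar_meager {G : Type} (op : (G -> Prop) -> Prop)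
  (mul : G -> G -> G) (A : G -> Prop) : Prop :=
  exists B : G -> Prop, borel op B /\ (forall x, A x -> B x) /\
  exists (K : Type) (dK : K -> K -> R) (f : K -> G),
    is_metric dK /\ compact (metric_open dK) /\ inhabited K /\
    continuous (metric_open dK) op f /\
    forall g h : G,
      meager (metric_open dK) (fun k => exists b, B b /\ f k = mul (mul g b) h).

Definition prod_mul {G1 G2 : Type} (m1 : G1 -> G1 -> G1) (m2 : G2 -> G2 -> G2)
  (p q : G1 * G2) : G1 * G2 := (m1 (fst p) (fst q), m2 (snd p) (snd q)).

Definition setX {X Y : Type} (A : X -> Prop) (B : Y -> Prop) (p : X * Y) : Prop :=
  A (fst p) /\ B (snd p).

(* Main.v *)
Require Import Defs.
From Stdlib Require Import Reals List.
From Stdlib Require Import Lra Lia Classical IndefiniteDescription Cantor.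
From Stdlib Require Import FunctionalExtensionality PropExtensionality.
Set Implicit Arguments.

(** If [A1 x A2] lies in a Borel set [B], a Lusin-type separation argument (the complement of
    [B] is a Souslin set) produces a Borel rectangle [B1 x B2] between [A1 x A2] and [B], so
    only Borel factors have to be considered. If [B1] is not Haar meager, then for a witness
    [(f1, f2)] on [K] of the Haar meagerness of [B] some preimage [f1^-1 (g1 B1 h1)] is
    nonmeager, hence comeager in a nonempty open set by the Baire property; restricting [f2]
    to the closure of a ball inside it gives a witness for [B2]. The converse only needs
    pulling Haar meager sets back along the two projections. *)

(** * Borel sets *)

Lemma pred_ext {X : Type} (A B : X -> Prop) : (forall x, A x <-> B x) -> A = B.
Proof.
  intros H. apply functional_extensionality. intros x.
  apply propositional_extensionality. apply H.
Qed.

Lemma borel_open {X : Type} (op : (X -> Prop) -> Prop) (U : X -> Prop) :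
  op U -> borel op U.
Proof. intros HU S H1 H2 H3. auto. Qed.

Lemma borel_compl {X : Type} (op : (X -> Prop) -> Prop) (A : X -> Prop) :
  borel op A -> borel op (fun x => ~ A x).
Proof. intros HA S H1 H2 H3. apply H2. apply HA; auto. Qed.

Lemma borel_union {X : Type} (op : (X -> Prop) -> Prop) (A : nat -> X -> Prop) :
  (forall n, borel op (A n)) -> borel op (fun x => exists n, A n x).
Proof. intros HA S H1 H2 H3. apply H3. intros n. apply HA; auto. Qed.

Lemma borel_inter {X : Type} (op : (X -> Prop) -> Prop) (A : nat -> X -> Prop) :
  (forall n, borel op (A n)) -> borel op (fun x => forall n, A n x).
Proof.
  intros HA.
  replace (fun x => forall n, A n x) with (fun x => ~ exists n, ~ A n x).
  - apply borel_compl. apply borel_union. intros n. apply borel_compl, HA.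
  - apply pred_ext. intros x. split.
    + intros H n. apply NNPP. intros Hn. apply H. exists n. exact Hn.
    + intros H [n Hn]. apply Hn, H.
Qed.

(** [borel] quantifies over all families closed under the Borel operations, so instantiating it with
    the family of sets whose preimage is Borel performs the induction on Borel sets. *)
Lemma borel_preimage {X Y : Type} (opX : (X -> Prop) -> Prop)
  (opY : (Y -> Prop) -> Prop) (f : X -> Y) (B : Y -> Prop) :
  continuous opX opY f -> borel opY B -> borel opX (fun x => B (f x)).
Proof.
  intros Hf HB. apply (HB (fun B => borel opX (fun x => B (f x)))).
  - intros U HU. apply borel_open, Hf, HU.
  - intros A. apply borel_compl.
  - intros A. apply (borel_union (fun n x => A n (f x))).
Qed.

(** * Metric topologies *)

Lemma metric_open_univ {X : Type} (d : X -> X -> R) : metric_open d (fun _ => True).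
Proof. intros x _. exists 1. split; [lra | trivial]. Qed.

Lemma metric_open_inter {X : Type} (d : X -> X -> R) (U V : X -> Prop) :
  metric_open d U -> metric_open d V -> metric_open d (fun x => U x /\ V x).
Proof.
  intros HU HV x [Ux Vx].
  destruct (HU x Ux) as [e [He H]]. destruct (HV x Vx) as [e' [He' H']].
  exists (Rmin e e'). split.
  - apply Rmin_pos; assumption.
  - intros y Hy. split; [apply H | apply H']; eapply Rlt_le_trans; try exact Hy.
    + apply Rmin_l.
    + apply Rmin_r.
Qed.

Lemma metric_open_union {X : Type} (d : X -> X -> R) (I : Type) (U : I -> X -> Prop) :
  (forall i, metric_open d (U i)) -> metric_open d (fun x => exists i, U i x).
Proof.
  intros HU x [i Ux]. destruct (HU i x Ux) as [e [He H]].
  exists e. split; [assumption |]. intros y Hy. exists i. auto.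
Qed.

Lemma metric_open_ball {X : Type} (d : X -> X -> R) (c : X) (r : R) :
  is_metric d -> metric_open d (fun x => d c x < r).
Proof.
  intros (_ & _ & _ & tri) x Hx. exists (r - d c x). split; [lra |].
  intros y Hy. specialize (tri c x y). lra.
Qed.

Lemma metric_refl {X : Type} (d : X -> X -> R) (x : X) : is_metric d -> d x x = 0.
Proof. intros (_ & H & _). apply H. reflexivity. Qed.

Lemma inv_succ_pos (n : nat) : 0 < / (INR n + 1).
Proof. apply Rinv_0_lt_compat. pose proof (pos_INR n). lra. Qed.

Lemma inv_succ_lt (e : R) : 0 < e -> exists n, / (INR n + 1) < e.
Proof.
  intros He. destruct (archimed_cor1 e He) as [N [H1 H2]].
  exists N. apply lt_0_INR in H2. apply Rlt_trans with (/ INR N); [| assumption].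
  apply Rinv_lt_contravar; [| lra]. apply Rmult_lt_0_compat; lra.
Qed.

(** The maximum is chosen because its balls are exactly products of balls of equal radius, which
    matches the rectangles in [prod_open]. *)
Definition max_dist {X Y : Type} (dX : X -> X -> R) (dY : Y -> Y -> R) (p q : X * Y) : R :=
  Rmax (dX (fst p) (fst q)) (dY (snd p) (snd q)).

Lemma max_dist_metric {X Y : Type} (dX : X -> X -> R) (dY : Y -> Y -> R) :
  is_metric dX -> is_metric dY -> is_metric (max_dist dX dY).
Proof.
  intros (p1 & z1 & s1 & t1) (p2 & z2 & s2 & t2). unfold max_dist.
  split; [| split; [| split]].
  - intros [x y] [x' y']. cbn. eapply Rle_trans; [apply (p1 x x') | apply Rmax_l].
  - intros [x y] [x' y']. cbn. split.
    + intros H. pose proof (Rmax_l (dX x x') (dY y y')).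
      pose proof (Rmax_r (dX x x') (dY y y')).
      specialize (p1 x x'). specialize (p2 y y').
      f_equal; [apply z1 | apply z2]; lra.
    + intros [= <- <-]. rewrite (proj2 (z1 _ _) eq_refl), (proj2 (z2 _ _) eq_refl).
      apply Rmax_left. lra.
  - intros x y. rewrite s1, s2. reflexivity.
  - intros [x x'] [y y'] [z z']. cbn.
    pose proof (Rmax_l (dX x y) (dY x' y')). pose proof (Rmax_r (dX x y) (dY x' y')).
    pose proof (Rmax_l (dX y z) (dY y' z')). pose proof (Rmax_r (dX y z) (dY y' z')).
    specialize (t1 x y z). specialize (t2 x' y' z'). apply Rmax_lub; lra.
Qed.

Lemma prod_open_max_dist {X Y : Type} (opX : (X -> Prop) -> Prop) (opY : (Y -> Prop) -> Prop)
  (dX : X -> X -> R) (dY : Y -> Y -> R) (W : X * Y -> Prop) :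
  is_metric dX -> is_metric dY ->
  (forall U, opX U <-> metric_open dX U) -> (forall U, opY U <-> metric_open dY U) ->
  prod_open opX opY W <-> metric_open (max_dist dX dY) W.
Proof.
  intros mX mY HX HY. split.
  - intros HW p Wp. destruct (HW p Wp) as (U & V & oU & oV & Up & Vp & HUV).
    destruct (proj1 (HX U) oU _ Up) as [e [He H]].
    destruct (proj1 (HY V) oV _ Vp) as [e' [He' H']].
    exists (Rmin e e'). split; [apply Rmin_pos; assumption |].
    intros [x y] Hq. unfold max_dist in Hq. cbn in Hq.
    apply HUV; [apply H | apply H']; eapply Rle_lt_trans.
    + apply Rmax_l.
    + eapply Rlt_le_trans; [exact Hq | apply Rmin_l].
    + apply Rmax_r.
    + eapply Rlt_le_trans; [exact Hq | apply Rmin_r].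
  - intros HW p Wp. destruct (HW p Wp) as [e [He H]].
    exists (fun x => dX (fst p) x < e), (fun y => dY (snd p) y < e).
    repeat split.
    + apply HX, metric_open_ball, mX.
    + apply HY, metric_open_ball, mY.
    + rewrite metric_refl; assumption.
    + rewrite metric_refl; assumption.
    + intros a b Ha Hb. apply H. unfold max_dist. cbn. apply Rmax_lub_lt; assumption.
Qed.

Lemma continuous_fst {X Y : Type} (opX : (X -> Prop) -> Prop) (opY : (Y -> Prop) -> Prop) :
  opY (fun _ => True) -> continuous (prod_open opX opY) opX fst.
Proof.
  intros HY V oV p Vp. exists V, (fun _ => True). repeat split; auto.
Qed.

Lemma continuous_snd {X Y : Type} (opX : (X -> Prop) -> Prop) (opY : (Y -> Prop) -> Prop) :
  opX (fun _ => True) -> continuous (prod_open opX opY) opY snd.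
Proof.
  intros HX V oV p Vp. exists (fun _ => True), V. repeat split; auto.
Qed.

Lemma continuous_comp {X Y Z : Type} (opX : (X -> Prop) -> Prop) (opY : (Y -> Prop) -> Prop)
  (opZ : (Z -> Prop) -> Prop) (f : X -> Y) (g : Y -> Z) :
  continuous opX opY f -> continuous opY opZ g -> continuous opX opZ (fun x => g (f x)).
Proof. intros Hf Hg V oV. apply (Hf (fun y => V (g y))), Hg, oV. Qed.

Lemma continuous_pair {Z X Y : Type} (d : Z -> Z -> R) (opX : (X -> Prop) -> Prop)
  (opY : (Y -> Prop) -> Prop) (f : Z -> X) (g : Z -> Y) :
  continuous (metric_open d) opX f -> continuous (metric_open d) opY g ->
  continuous (metric_open d) (prod_open opX opY) (fun z => (f z, g z)).
Proof.
  intros Hf Hg W oW z Wz. destruct (oW _ Wz) as (U & V & oU & oV & Uz & Vz & H).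
  destruct (metric_open_inter (Hf U oU) (Hg V oV) (conj Uz Vz)) as [e [He H']].
  exists e. split; [assumption |]. intros y Hy. destruct (H' y Hy). auto.
Qed.

Lemma continuous_const {X Y : Type} (d : X -> X -> R) (opY : (Y -> Prop) -> Prop) (c : Y) :
  continuous (metric_open d) opY (fun _ => c).
Proof. intros V _ x Hx. exists 1. split; [lra | auto]. Qed.

(** * Souslin sets *)

(* [R a x] is closed in (Baire space) x X. *)
Definition closed_rel {X : Type} (op : (X -> Prop) -> Prop) (R : (nat -> nat) -> X -> Prop) :=
  forall a x, ~ R a x -> exists n W, op W /\ W x /\
    forall b y, (forall i, (i < n)%nat -> b i = a i) -> W y -> ~ R b y.

(** Membership is witnessed by a branch [a], which the separation argument later cuts into pieces by
    its initial segments. *)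
Definition souslin {X : Type} (op : (X -> Prop) -> Prop) (A : X -> Prop) : Prop :=
  exists R, closed_rel op R /\ forall x, A x <-> exists a, R a x.

Lemma souslin_iff {X : Type} (op : (X -> Prop) -> Prop) (A B : X -> Prop) :
  (forall x, A x <-> B x) -> souslin op A -> souslin op B.
Proof.
  intros H [R [HR HA]]. exists R. split; [assumption |].
  intros x. rewrite <- H. apply HA.
Qed.

Lemma souslin_closed {X : Type} (op : (X -> Prop) -> Prop) (A : X -> Prop) :
  op (fun x => ~ A x) -> souslin op A.
Proof.
  intros HA. exists (fun _ x => A x). split.
  - intros a x Hx. exists O, (fun x => ~ A x). auto.
  - intros x. split.
    + intros Hx. exists (fun _ => O). exact Hx.
    + intros [_ Hx]. exact Hx.
Qed.

(** The first entry of a branch selects the index and the remaining entries witness membership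
    there. Closedness costs one extra coordinate, the one that fixes the index. *)
Lemma souslin_union {X : Type} (op : (X -> Prop) -> Prop) (A : nat -> X -> Prop) :
  (forall n, souslin op (A n)) -> souslin op (fun x => exists n, A n x).
Proof.
  intros H. apply functional_choice in H. destruct H as [R HR].
  exists (fun a x => R (a O) (fun i => a (S i)) x). split.
  - intros a x Hx. destruct (proj1 (HR (a O)) _ x Hx) as (n & W & oW & Wx & HW).
    exists (S n), W. repeat split; try assumption.
    intros b y Hb Wy. rewrite (Hb O) by lia. apply HW; [| assumption].
    intros i Hi. apply Hb. lia.
  - intros x. split.
    + intros [n Hn]. apply (HR n) in Hn. destruct Hn as [a Ha].
      exists (fun i => match i with O => n | S j => a j end). exact Ha.
    + intros [a Ha]. exists (a O). apply HR. eexists. exact Ha.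
Qed.

(** Cantor pairing packs one witness for each [k] into a single branch. Failure at one [k] is
    decided by finitely many entries of that branch, so the combined relation stays closed. *)
Lemma souslin_inter {X : Type} (op : (X -> Prop) -> Prop) (A : nat -> X -> Prop) :
  (forall n, souslin op (A n)) -> souslin op (fun x => forall n, A n x).
Proof.
  intros H. apply functional_choice in H. destruct H as [R HR].
  exists (fun a x => forall k, R k (fun i => a (to_nat (k, i))) x). split.
  - intros a x Hx. apply not_all_ex_not in Hx. destruct Hx as [k Hk].
    destruct (proj1 (HR k) _ x Hk) as (n & W & oW & Wx & HW).
    (* Agreement of the packed branches below [N] forces agreement of their [k]-th components below
       [n]. *)
    assert (HN : exists N, forall i, (i < n)%nat -> (to_nat (k, i) < N)%nat).
    { clear. induction n as [|n [N HN]].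
      - exists O. lia.
      - exists (N + S (to_nat (k, n)))%nat. intros i Hi.
        destruct (Nat.eq_dec i n) as [-> | Hne]; [lia |].
        specialize (HN i). lia. }
    destruct HN as [N HN]. exists N, W. repeat split; try assumption.
    intros b y Hb Wy Hall. apply (HW (fun i => b (to_nat (k, i))) y); auto.
  - intros x. split.
    + intros Hx.
      assert (H : forall k, exists a, R k a x) by (intros k; apply HR, Hx).
      apply functional_choice in H. destruct H as [a Ha].
      exists (fun m => a (fst (of_nat m)) (snd (of_nat m))). intros k.
      replace (fun i => _) with (a k); [apply Ha |].
      apply functional_extensionality. intros i. rewrite cancel_of_to. reflexivity.
    + intros [a Ha] n. apply HR. eexists. apply Ha.
Qed.

(** In a metric space an open set is a countable union of closed sets: for each [n], take the points
    whose ball of radius [1/(n+1)] stays inside [U]. *)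
Lemma souslin_open {X : Type} (op : (X -> Prop) -> Prop) (d : X -> X -> R) (U : X -> Prop) :
  is_metric d -> (forall V, op V <-> metric_open d V) -> op U -> souslin op U.
Proof.
  intros md Hop oU.
  apply souslin_iff
    with (fun x => exists n, forall y, d x y < / (INR n + 1) -> U y).
  - intros x. split.
    + intros [n Hn]. apply Hn. rewrite metric_refl by assumption. apply inv_succ_pos.
    + intros Ux. destruct (proj1 (Hop U) oU x Ux) as [e [He H]].
      destruct (inv_succ_lt He) as [n Hn]. exists n. intros y Hy. apply H. lra.
  - apply (souslin_union (fun n x => forall y, d x y < / (INR n + 1) -> U y)).
    intros n. apply souslin_closed, Hop. intros x Hx.
    apply not_all_ex_not in Hx. destruct Hx as [y Hy].
    apply imply_to_and in Hy. destruct Hy as [Hxy Uy].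
    exists (/ (INR n + 1) - d x y). split; [lra |].
    intros z Hz Hall. apply Uy, Hall. destruct md as (_ & _ & sym & tri).
    specialize (tri z x y). rewrite (sym z x) in tri. lra.
Qed.

Lemma borel_souslin {X : Type} (op : (X -> Prop) -> Prop) (d : X -> X -> R) (B : X -> Prop) :
  is_metric d -> (forall V, op V <-> metric_open d V) -> borel op B -> souslin op B.
Proof.
  intros md Hop HB.
  (* Souslin sets are not closed under complement in general, so the induction carries the set
     together with its complement. *)
  apply (HB (fun B => souslin op B /\ souslin op (fun x => ~ B x))).
  - intros U oU. split.
    + eapply souslin_open; eassumption.
    + apply souslin_closed. replace (fun x => ~ ~ U x) with U; [assumption |].
      apply pred_ext. intros x. split; [tauto | apply NNPP].
  - intros A [H1 H2]. split; [assumption |].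
    apply souslin_iff with A; [| assumption]. intros x. split; [tauto | apply NNPP].
  - intros A HA. split.
    + apply souslin_union. intros n. apply HA.
    + apply souslin_iff with (fun x => forall n, ~ A n x).
      * intros x. split; [intros H [n Hn]; exact (H n Hn) | intros H n Hn; apply H; eauto].
      * apply (souslin_inter (fun n x => ~ A n x)). intros n. apply HA.
Qed.

(** * Separation by Borel rectangles *)

(* Initial segments are stored in reverse order, so that extending is consing. *)
Fixpoint prefix (a : nat -> nat) (n : nat) : list nat :=
  match n with O => nil | S m => a m :: prefix a m end.

Lemma prefix_length (a : nat -> nat) (n : nat) : length (prefix a n) = n.
Proof. induction n; cbn; congruence. Qed.

Lemma prefix_eq (a b : nat -> nat) (n : nat) :
  prefix a n = prefix b n -> forall i, (i < n)%nat -> a i = b i.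
Proof.
  induction n as [|n IH]; intros H i Hi; [lia |].
  cbn in H. injection H as H1 H2.
  destruct (Nat.eq_dec i n) as [-> | Hne]; [assumption |]. apply IH; [assumption | lia].
Qed.

(** Dependent choice along three sequences at once; [P] will say that separation fails on the pieces
    named by three finite sequences. *)
Lemma three_branches (P : list nat -> list nat -> list nat -> Prop) :
  P nil nil nil ->
  (forall s t u, P s t u -> exists i j k, P (i :: s) (j :: t) (k :: u)) ->
  exists a b c, forall n, P (prefix a n) (prefix b n) (prefix c n).
Proof.
  intros H0 HS.
  assert (H : forall st : list nat * list nat * list nat, exists ijk : nat * nat * nat,
    let '(s, t, u) := st in let '(i, j, k) := ijk in
    P s t u -> P (i :: s) (j :: t) (k :: u)).
  { intros [[s t] u]. destruct (classic (P s t u)) as [Hp | Hn].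
    - destruct (HS s t u Hp) as (i & j & k & H). exists (i, j, k). auto.
    (* Dummy value: [functional_choice] needs an answer also at triples where [P] fails. *)
    - exists (O, O, O). tauto. }
  apply functional_choice in H. destruct H as [F HF].
  pose (st := nat_rect (fun _ => (list nat * list nat * list nat)%type) (nil, nil, nil)
    (fun _ x => (fst (fst (F x)) :: fst (fst x), snd (fst (F x)) :: snd (fst x),
                 snd (F x) :: snd x))).
  exists (fun n => fst (fst (F (st n)))), (fun n => snd (fst (F (st n)))),
    (fun n => snd (F (st n))).
  assert (E : forall n, st n = (prefix (fun n => fst (fst (F (st n)))) n,
    prefix (fun n => snd (fst (F (st n)))) n, prefix (fun n => snd (F (st n))) n)).
  { induction n as [|n IH]; [reflexivity |].
    change (st (S n)) with (fst (fst (F (st n))) :: fst (fst (st n)),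
      snd (fst (F (st n))) :: snd (fst (st n)), snd (F (st n)) :: snd (st n)).
    (* Only the tails are rewritten; the [st n] under [F] must stay to match the heads of the
       prefixes. *)
    cbn [prefix]. rewrite IH at 2 4 6. reflexivity. }
  assert (Q : forall n, P (fst (fst (st n))) (snd (fst (st n))) (snd (st n))).
  { induction n as [|n IH]; [exact H0 |]. cbn.
    specialize (HF (st n)). destruct (st n) as [[s t] u]. destruct (F (s, t, u)) as [[i j] k].
    apply HF, IH. }
  intros n. specialize (Q n). rewrite (E n) in Q. exact Q.
Qed.

(* [code] numbers a dense set [D] injectively; [y] lies in the cell of [s] when it is
   [1/(k+1)]-close to the point of [D] numbered by the [k]-th entry, for each [k]. *)
Fixpoint cell {Y : Type} (d : Y -> Y -> R) (D : Y -> Prop) (code : Y -> nat)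
  (s : list nat) (y : Y) : Prop :=
  match s with
  | nil => True
  | i :: t => (exists c, D c /\ code c = i /\ d y c < / (INR (length t) + 1)) /\
              cell d D code t y
  end.

Lemma cell_prefix {Y : Type} (d : Y -> Y -> R) (D : Y -> Prop) (code : Y -> nat)
  (a : nat -> nat) (n k : nat) (y : Y) :
  (k < n)%nat -> cell d D code (prefix a n) y ->
  exists c, D c /\ code c = a k /\ d y c < / (INR k + 1).
Proof.
  induction n as [|n IH]; intros Hk H; [lia |]. cbn in H. destruct H as [H1 H2].
  destruct (Nat.eq_dec k n) as [-> | Hne].
  - rewrite prefix_length in H1. exact H1.
  - apply IH; [lia | assumption].
Qed.

Lemma cell_split {Y : Type} (d : Y -> Y -> R) (D : Y -> Prop) (code : Y -> nat)
  (s : list nat) (y : Y) :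
  is_metric d ->
  (forall U, metric_open d U -> (exists x, U x) -> exists x, U x /\ D x) ->
  cell d D code s y -> exists i, cell d D code (i :: s) y.
Proof.
  intros md dense H.
  destruct (dense (fun c => d y c < / (INR (length s) + 1))) as [c [Hc Dc]].
  - apply metric_open_ball, md.
  - exists y. rewrite metric_refl by assumption. apply inv_succ_pos.
  - exists (code c). cbn. split; [exists c; auto | assumption].
Qed.

(** By injectivity of [code], entry [k] gives all points of the later cells one common centre, so
    diameters tend to zero and chosen points form a Cauchy sequence. The cells are not closed, so
    the limit is only claimed to be close to them, not inside them. *)
Lemma cell_converge {Y : Type} (d : Y -> Y -> R) (D : Y -> Prop) (code : Y -> nat)
  (a : nat -> nat) :
  is_metric d -> cauchy_complete d ->
  (forall x y, D x -> D y -> code x = code y -> x = y) ->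
  (forall n, exists y, cell d D code (prefix a n) y) ->
  exists y, forall e, 0 < e -> exists N, forall n, (N <= n)%nat ->
    forall z, cell d D code (prefix a n) z -> d y z < e.
Proof.
  intros (_ & _ & sym & tri) Hc Hinj Hne.
  assert (small : forall e, 0 < e -> exists N, forall m n y z, (N <= m)%nat -> (N <= n)%nat ->
    cell d D code (prefix a m) y -> cell d D code (prefix a n) z -> d y z < e).
  { intros e He. destruct (@inv_succ_lt (e / 2)) as [k Hk]; [lra |].
    (* A prefix must have length at least [S k] to contain the entry with index [k]. *)
    exists (S k). intros m n y z Hm Hn Hy Hz.
    destruct (@cell_prefix _ d D code a m k y Hm Hy) as (c & Dc & Ec & Hyc).
    destruct (@cell_prefix _ d D code a n k z Hn Hz) as (c' & Dc' & Ec' & Hzc).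
    assert (c = c') as <- by (apply Hinj; congruence).
    specialize (tri y c z). rewrite (sym c z) in tri. lra. }
  apply functional_choice in Hne. destruct Hne as [u Hu].
  destruct (Hc u) as [y Hy].
  - intros e He. destruct (small e He) as [N HN]. exists N. intros m n Hm Hn.
    apply (HN m n); auto.
  - exists y. intros e He.
    destruct (small (e / 2)) as [N HN]; [lra |].
    destruct (Hy (e / 2)) as [M HM]; [lra |].
    exists N. intros n Hn z Hz.
    specialize (HM (N + M)%nat ltac:(lia)).
    specialize (HN (N + M)%nat n (u (N + M)%nat) z ltac:(lia) Hn (Hu _) Hz).
    specialize (tri y (u (N + M)%nat) z). rewrite (sym y (u (N + M)%nat)) in tri. lra.
Qed.

(** For [C] the complement of a Borel hull of the product of [A1] and [A2], such a rectangle lies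
    between that product and its hull. *)
Definition rect_sep {X Y : Type} (opX : (X -> Prop) -> Prop) (opY : (Y -> Prop) -> Prop)
  (A1 : X -> Prop) (A2 : Y -> Prop) (C : X * Y -> Prop) : Prop :=
  exists B1 B2, borel opX B1 /\ borel opY B2 /\
    (forall x, A1 x -> B1 x) /\ (forall y, A2 y -> B2 y) /\
    forall x y, B1 x -> B2 y -> ~ C (x, y).

Section RectangleSeparation.

Variables (X Y : Type) (opX : (X -> Prop) -> Prop) (opY : (Y -> Prop) -> Prop).
Hypotheses (opXT : opX (fun _ => True)) (opYT : opY (fun _ => True)).

(** Unite on the split side and intersect on the other: a point of the union picks some [n], and the
    intersection puts the second coordinate into the matching [B2 n]. *)
Lemma rect_sep_union_l (A1 : nat -> X -> Prop) (A A2 : _ -> Prop) (C : X * Y -> Prop) :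
  (forall x, A x -> exists n, A1 n x) ->
  (forall n, rect_sep opX opY (A1 n) A2 C) -> rect_sep opX opY A A2 C.
Proof.
  intros HA H. apply functional_choice in H. destruct H as [B1 H].
  apply functional_choice in H. destruct H as [B2 H].
  exists (fun x => exists n, B1 n x), (fun y => forall n, B2 n y). repeat split.
  - apply borel_union. intros n. apply H.
  - apply borel_inter. intros n. apply H.
  - intros x Hx. destruct (HA x Hx) as [n Hn]. exists n. apply H, Hn.
  - intros y Hy n. apply H, Hy.
  - intros x y [n Hx] Hy. destruct (H n) as (_ & _ & _ & _ & Hn). apply Hn; auto.
Qed.

Lemma rect_sep_union_r (A1 A : _ -> Prop) (A2 : nat -> Y -> Prop) (C : X * Y -> Prop) :
  (forall y, A y -> exists n, A2 n y) ->
  (forall n, rect_sep opX opY A1 (A2 n) C) -> rect_sep opX opY A1 A C.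
Proof.
  intros HA H. apply functional_choice in H. destruct H as [B1 H].
  apply functional_choice in H. destruct H as [B2 H].
  exists (fun x => forall n, B1 n x), (fun y => exists n, B2 n y). repeat split.
  - apply borel_inter. intros n. apply H.
  - apply borel_union. intros n. apply H.
  - intros x Hx n. apply H, Hx.
  - intros x Hx. destruct (HA x Hx) as [n Hn]. exists n. apply H, Hn.
  - intros x y Hx [n Hy]. destruct (H n) as (_ & _ & _ & _ & Hn). apply Hn; auto.
Qed.

(** The rectangle must now avoid every [C n], so both factors are intersected. *)
Lemma rect_sep_union_target (A1 A2 : _ -> Prop) (C : nat -> X * Y -> Prop) (C' : X * Y -> Prop) :
  (forall p, C' p -> exists n, C n p) ->
  (forall n, rect_sep opX opY A1 A2 (C n)) -> rect_sep opX opY A1 A2 C'.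
Proof.
  intros HA H. apply functional_choice in H. destruct H as [B1 H].
  apply functional_choice in H. destruct H as [B2 H].
  exists (fun x => forall n, B1 n x), (fun y => forall n, B2 n y). repeat split.
  - apply borel_inter. intros n. apply H.
  - apply borel_inter. intros n. apply H.
  - intros x Hx n. apply H, Hx.
  - intros y Hy n. apply H, Hy.
  - intros x y Hx Hy Hp. destruct (HA _ Hp) as [n Hn].
    destruct (H n) as (_ & _ & _ & _ & Hn'). apply (Hn' x y); auto.
Qed.

(** Used contrapositively: along branches where separation fails, all cells are nonempty. *)
Lemma rect_sep_empty_l (A1 A2 : _ -> Prop) (C : X * Y -> Prop) :
  ~ (exists x, A1 x) -> rect_sep opX opY A1 A2 C.
Proof.
  intros H. exists (fun _ => ~ True), (fun _ => True). repeat split.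
  - apply borel_compl, borel_open, opXT.
  - apply borel_open, opYT.
  - intros x Hx _. apply H. eauto.
  - intros x y F. tauto.
Qed.

Lemma rect_sep_empty_r (A1 A2 : _ -> Prop) (C : X * Y -> Prop) :
  ~ (exists y, A2 y) -> rect_sep opX opY A1 A2 C.
Proof.
  intros H. exists (fun _ => True), (fun _ => ~ True). repeat split.
  - apply borel_open, opXT.
  - apply borel_compl, borel_open, opYT.
  - intros y Hy _. apply H. eauto.
  - intros x y _ F. tauto.
Qed.

(* As in Lusin's separation theorem: if separation fails, it fails on ever smaller pieces
   of the two parametrizing Polish spaces and of Baire space; at the limit point the
   rectangle of opens given by closedness of the Souslin relation does separate. *)
Lemma analytic_souslin_rect_sep (A1 : X -> Prop) (A2 : Y -> Prop) (C : X * Y -> Prop) :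
  analytic opX A1 -> analytic opY A2 -> souslin (prod_open opX opY) C ->
  (forall x y, A1 x -> A2 y -> ~ C (x, y)) -> rect_sep opX opY A1 A2 C.
Proof.
  intros (Z1 & o1 & f1 & ((d1 & m1 & c1 & e1) & D1 & (k1 & i1) & n1) & cf1 & HA1).
  intros (Z2 & o2 & f2 & ((d2 & m2 & c2 & e2) & D2 & (k2 & i2) & n2) & cf2 & HA2).
  intros (R & HR & HC) Hdisj.
  (* The pieces of [A1] and [A2] are images of cells; the piece of [C] collects the points having a
     Souslin witness that starts with [s]. At [nil] these are the whole sets. *)
  pose (P1 := fun s x => exists z, cell d1 D1 k1 s z /\ f1 z = x).
  pose (P2 := fun s x => exists z, cell d2 D2 k2 s z /\ f2 z = x).
  pose (P3 := fun s p => exists a, prefix a (length s) = s /\ R a p).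
  apply NNPP. intros Hns.
  destruct (@three_branches (fun s t u => ~ rect_sep opX opY (P1 s) (P2 t) (P3 u)))
    as (a & b & c & H).
  - intros (B1 & B2 & bB1 & bB2 & H1 & H2 & H3). apply Hns. exists B1, B2.
    repeat split; try assumption.
    + intros x Hx. apply HA1 in Hx. destruct Hx as [z Hz]. apply H1. exists z. cbn. auto.
    + intros x Hx. apply HA2 in Hx. destruct Hx as [z Hz]. apply H2. exists z. cbn. auto.
    + intros x y Hx Hy Hxy. apply HC in Hxy. destruct Hxy as [g Hg].
      apply (H3 x y Hx Hy). exists g. auto.
  - intros s t u Hst. apply NNPP. intros Hno. apply Hst.
    (* If all triples of children were separated, three countable recombinations would separate the
       parents. *)
    apply rect_sep_union_l with (fun i => P1 (i :: s)).
    { intros x (z & Hz & <-). destruct (@cell_split _ d1 D1 k1 s z) as [i Hi]; auto.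
      - intros U oU. apply n1, e1, oU.
      - exists i, z. auto. }
    intros i. apply rect_sep_union_r with (fun j => P2 (j :: t)).
    { intros x (z & Hz & <-). destruct (@cell_split _ d2 D2 k2 t z) as [j Hj]; auto.
      - intros U oU. apply n2, e2, oU.
      - exists j, z. auto. }
    intros j. apply rect_sep_union_target with (fun k => P3 (k :: u)).
    { intros p (g & Hg & HRg). exists (g (length u)), g. cbn. rewrite Hg. auto. }
    intros k. apply NNPP. intros Hn. apply Hno. exists i, j, k. exact Hn.
  - destruct (@cell_converge _ d1 D1 k1 a m1 c1 i1) as [y1 Hy1].
    { intros n. apply NNPP. intros Hn. apply (H n). apply rect_sep_empty_l.
      intros (x & z & Hz & _). apply Hn. eauto. }
    destruct (@cell_converge _ d2 D2 k2 b m2 c2 i2) as [y2 Hy2].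
    { intros n. apply NNPP. intros Hn. apply (H n). apply rect_sep_empty_r.
      intros (x & z & Hz & _). apply Hn. eauto. }
    (* The limit point lies in the product of [A1] and [A2], hence outside [C], so no branch
       witnesses it, in particular not [c]. *)
    assert (HnR : ~ R c (f1 y1, f2 y2)).
    { intros Hc. apply (Hdisj (f1 y1) (f2 y2)).
      - apply HA1. eauto.
      - apply HA2. eauto.
      - apply HC. eauto. }
    destruct (HR _ _ HnR) as (n & W & oW & Wp & HW).
    destruct (oW _ Wp) as (U & V & oU & oV & Up & Vp & HUV). cbn in Up, Vp.
    destruct (proj1 (e1 _) (cf1 U oU) y1 Up) as [r1 [r1p Hr1]].
    destruct (proj1 (e2 _) (cf2 V oV) y2 Vp) as [r2 [r2p Hr2]].
    destruct (Hy1 r1 r1p) as [N1 HN1]. destruct (Hy2 r2 r2p) as [N2 HN2].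
    (* At this depth both cells lie in the balls mapped into [U] and [V], and the prefix fixes the
       first [n] entries of the Souslin branch. *)
    apply (H (n + N1 + N2)%nat). exists U, V. repeat split.
    + apply borel_open, oU.
    + apply borel_open, oV.
    + intros x (z & Hz & <-). apply Hr1. eapply HN1; [| exact Hz]. lia.
    + intros x (z & Hz & <-). apply Hr2. eapply HN2; [| exact Hz]. lia.
    + intros x y Ux Vy (g & Hg & HRg). rewrite prefix_length in Hg.
      apply (HW g (x, y)); auto.
      intros i Hi. apply (prefix_eq _ _ Hg). lia.
Qed.

End RectangleSeparation.

(** * Baire category *)

Lemma meager_subset {X : Type} (op : (X -> Prop) -> Prop) (M N : X -> Prop) :
  (forall x, M x -> N x) -> meager op N -> meager op M.
Proof. intros H [S [H1 H2]]. exists S. auto. Qed.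

Lemma meager_Union {X : Type} (op : (X -> Prop) -> Prop) (M : nat -> X -> Prop) :
  (forall n, meager op (M n)) -> meager op (fun x => exists n, M n x).
Proof.
  intros H. apply functional_choice in H. destruct H as [N HN].
  exists (fun m => N (fst (of_nat m)) (snd (of_nat m))). split.
  - intros m. apply HN.
  - intros x [n Hn]. apply HN in Hn. destruct Hn as [k Hk].
    exists (to_nat (n, k)). rewrite cancel_of_to. exact Hk.
Qed.

Lemma meager_union {X : Type} (op : (X -> Prop) -> Prop) (M N : X -> Prop) :
  meager op M -> meager op N -> meager op (fun x => M x \/ N x).
Proof.
  intros HM HN.
  apply meager_subset with (fun x => exists n : nat, match n with O => M x | _ => N x end).
  - intros x [H | H]; [exists O | exists 1%nat]; assumption.
  - apply (meager_Union (fun n x => match n with O => M x | _ => N x end)).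
    intros [|n]; assumption.
Qed.

Lemma nowhere_dense_meager {X : Type} (op : (X -> Prop) -> Prop) (N : X -> Prop) :
  nowhere_dense op N -> meager op N.
Proof. intros H. exists (fun _ => N). split; [auto |]. intros x Hx. exists O. exact Hx. Qed.

Definition exterior {X : Type} (d : X -> X -> R) (U : X -> Prop) (x : X) : Prop :=
  exists W, metric_open d W /\ W x /\ forall y, W y -> ~ U y.

Lemma exterior_open {X : Type} (d : X -> X -> R) (U : X -> Prop) :
  metric_open d (exterior d U).
Proof.
  intros x (W & oW & Wx & H). destruct (oW x Wx) as [e [He HW]].
  exists e. split; [assumption |]. intros y Hy. exists W. auto.
Qed.

(** An open [O] either meets [U], and then the open set of common points misses the boundary, or is
    disjoint from [U] and lies in its exterior. *)
Lemma boundary_nowhere_dense {X : Type} (d : X -> X -> R) (U : X -> Prop) :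
  metric_open d U -> nowhere_dense (metric_open d) (fun x => ~ U x /\ ~ exterior d U x).
Proof.
  intros oU O oO HO. destruct (classic (exists x, O x /\ U x)) as [HOU | HOU].
  - exists (fun x => O x /\ U x). repeat split; try tauto.
    apply metric_open_inter; assumption.
  - exists O. repeat split; try assumption; try tauto.
    intros x Ox [_ Hx]. apply Hx. exists O. repeat split; try assumption.
    intros y Oy Uy. apply HOU. eauto.
Qed.

Definition baire_property {X : Type} (d : X -> X -> R) (E : X -> Prop) : Prop :=
  exists U, metric_open d U /\ meager (metric_open d) (fun x => ~ (E x <-> U x)).

(** The complement of [U] need not be open; it is replaced by the exterior, from which it differs
    only by the nowhere dense boundary. *)
Lemma baire_property_compl {X : Type} (d : X -> X -> R) (E : X -> Prop) :
  baire_property d E -> baire_property d (fun x => ~ E x).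
Proof.
  intros (U & oU & HU). exists (exterior d U). split; [apply exterior_open |].
  apply meager_subset
    with (fun x => ~ (E x <-> U x) \/ (~ U x /\ ~ exterior d U x)).
  - intros x Hx.
    assert (H : exterior d U x -> ~ U x) by (intros (W & _ & Wx & HW); auto).
    destruct (classic (E x)); destruct (classic (U x)); tauto.
  - apply meager_union; [assumption |].
    apply nowhere_dense_meager, boundary_nowhere_dense, oU.
Qed.

Lemma baire_property_union {X : Type} (d : X -> X -> R) (E : nat -> X -> Prop) :
  (forall n, baire_property d (E n)) -> baire_property d (fun x => exists n, E n x).
Proof.
  intros H. apply functional_choice in H. destruct H as [U HU].
  exists (fun x => exists n, U n x). split.
  - apply metric_open_union. intros n. apply HU.
  - apply meager_subset with (fun x => exists n, ~ (E n x <-> U n x)).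
    + intros x Hx. apply NNPP. intros Hn. apply Hx.
      assert (H : forall n, E n x <-> U n x) by (intros n; apply NNPP; eauto).
      split; intros [n Hn']; exists n; apply H, Hn'.
    + apply (meager_Union (fun n x => ~ (E n x <-> U n x))). intros n. apply HU.
Qed.

Lemma baire_property_borel_preimage {K X : Type} (d : K -> K -> R) (op : (X -> Prop) -> Prop)
  (f : K -> X) (B : X -> Prop) :
  continuous (metric_open d) op f -> borel op B -> baire_property d (fun k => B (f k)).
Proof.
  intros Hf HB. apply (HB (fun B => baire_property d (fun k => B (f k)))).
  - intros U oU. exists (fun k => U (f k)). split; [apply Hf, oU |].
    exists (fun _ _ => False). split.
    + intros _ O oO HO. exists O. auto.
    + tauto.
  - intros A. apply baire_property_compl.
  - intros A. apply (baire_property_union (fun n k => A n (f k))).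
Qed.

Lemma baire_property_nonmeager {X : Type} (d : X -> X -> R) (E : X -> Prop) :
  baire_property d E -> ~ meager (metric_open d) E ->
  exists U, metric_open d U /\ (exists x, U x) /\
    meager (metric_open d) (fun x => U x /\ ~ E x).
Proof.
  intros (U & oU & HU) HE. exists U. repeat split; [assumption | |].
  - apply NNPP. intros Hn. apply HE. apply meager_subset with (2 := HU).
    (* Were [U] empty, all of [E] would lie in the meager symmetric difference. *)
    intros x Ex [H _]. apply Hn. eauto.
  - apply meager_subset with (2 := HU). tauto.
Qed.

(** * Subspaces *)

Definition sub_dist {X : Type} (d : X -> X -> R) (P : X -> Prop) (x y : {x | P x}) : R :=
  d (proj1_sig x) (proj1_sig y).

Definition closure {X : Type} (d : X -> X -> R) (V : X -> Prop) (x : X) : Prop :=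
  forall e, 0 < e -> exists v, V v /\ d x v < e.

Lemma sub_dist_metric {X : Type} (d : X -> X -> R) (P : X -> Prop) :
  is_metric d -> is_metric (sub_dist d P).
Proof.
  intros (p & z & s & t). unfold sub_dist. repeat split; auto.
  - destruct x as [x Hx], y as [y Hy]. cbn. intros H. apply z in H. subst y.
    f_equal. apply proof_irrelevance.
  - intros <-. apply z. reflexivity.
Qed.

Lemma continuous_proj1_sig {X : Type} (d : X -> X -> R) (P : X -> Prop) :
  continuous (metric_open (sub_dist d P)) (metric_open d) (@proj1_sig X P).
Proof.
  intros V oV x Vx. destruct (oV _ Vx) as [e [He H]]. exists e. split; [assumption |].
  intros y Hy. apply H, Hy.
Qed.

Lemma closure_compl_open {X : Type} (d : X -> X -> R) (V : X -> Prop) :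
  is_metric d -> metric_open d (fun x => ~ closure d V x).
Proof.
  intros (_ & _ & sym & tri) x Hx. apply not_all_ex_not in Hx. destruct Hx as [e He].
  apply imply_to_and in He. destruct He as [He Hv].
  exists (e / 2). split; [lra |]. intros y Hy Hcl.
  destruct (Hcl (e / 2)) as [v [Vv Hd]]; [lra |]. apply Hv. exists v. split; [assumption |].
  specialize (tri x y v). lra.
Qed.

Lemma compact_closed_subspace {X : Type} (d : X -> X -> R) (P : X -> Prop) :
  is_metric d -> Defs.compact (metric_open d) -> metric_open d (fun x => ~ P x) ->
  Defs.compact (metric_open (sub_dist d P)).
Proof.
  intros md Hc HP I U oU HU.
  (* Each relatively open [U i] is extended to an open set of [X] with the same trace on [P]; the
     index [None] adds the complement of [P], and is dropped from the finite subcover at the end. *)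
  pose (O := fun (i : option I) x => match i with
    | None => ~ P x
    | Some i => exists e, 0 < e /\ forall y : {x | P x}, d x (proj1_sig y) < e -> U i y end).
  destruct (Hc (option I) O) as [l Hl].
  - intros [i|]; [| exact HP]. intros x (e & He & H).
    exists (e / 2). split; [lra |]. intros y Hy. exists (e / 2). split; [lra |].
    intros z Hz. apply H. destruct md as (_ & _ & _ & tri).
    specialize (tri x y (proj1_sig z)). lra.
  - intros x. destruct (classic (P x)) as [Px | nPx]; [| exists None; exact nPx].
    destruct (HU (exist _ x Px)) as [i Hi]. exists (Some i).
    destruct (oU i _ Hi) as [e [He H]]. exists e. split; [assumption |].
    intros y Hy. apply H, Hy.
  - exists (flat_map (fun o => match o with Some i => i :: nil | None => nil end) l).
    intros x. destruct (Hl (proj1_sig x)) as [[i|] [Hin Hi]].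
    + exists i. split.
      * apply in_flat_map. exists (Some i). split; [assumption | left; reflexivity].
      * destruct Hi as (e & He & H). apply H. rewrite metric_refl; assumption.
    + destruct (Hi (proj2_sig x)).
Qed.

(** This is why closures of open sets are used: a nonempty relatively open subset meets [V] in a
    nonempty open set of [X], where nowhere density in [X] applies. In an arbitrary closed subspace,
    the trace of a meager set can be everything. *)
Lemma meager_closure_subspace {X : Type} (d : X -> X -> R) (V M : X -> Prop) :
  is_metric d -> metric_open d V -> meager (metric_open d) M ->
  meager (metric_open (sub_dist d (closure d V))) (fun x => M (proj1_sig x)).
Proof.
  intros md oV (N & HN & HM). exists (fun n x => N n (proj1_sig x)).
  split; [| intros x Hx; apply HM, Hx].
  intros n W oW [w Ww]. destruct (oW w Ww) as [e [He H]].
  destruct (HN n (fun x => V x /\ d (proj1_sig w) x < e)) as (O & oO & [o Oo] & HO & HON).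
  - apply metric_open_inter; [assumption | apply metric_open_ball, md].
  - destruct (proj2_sig w e He) as [v Hv]. eauto.
  - exists (fun x => O (proj1_sig x)). repeat split.
    + apply continuous_proj1_sig, oO.
    + assert (Ho : closure d V o).
      { intros r Hr. exists o. split; [apply HO, Oo |]. rewrite metric_refl; assumption. }
      exists (exist _ o Ho). exact Oo.
    + intros x Hx. apply H. apply HO, Hx.
    + intros x Hx. apply HON, Hx.
Qed.

(** * Haar meager sets *)

Lemma haar_meager_subset {G : Type} (op : (G -> Prop) -> Prop) (mul : G -> G -> G)
  (A A' : G -> Prop) :
  (forall x, A x -> A' x) -> haar_meager op mul A' -> haar_meager op mul A.
Proof. intros H (B & bB & HB & HK). exists B. auto. Qed.

(** The section [s] lifts the witness [f] to [G], and the homomorphism [p] sends a translate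
    upstairs to a translate of [B]. Continuity of [s] is phrased on maps from metric spaces, the
    form [continuous_pair] provides. *)
Lemma haar_meager_preimage {G H : Type} (opG : (G -> Prop) -> Prop) (opH : (H -> Prop) -> Prop)
  (mulG : G -> G -> G) (mulH : H -> H -> H) (p : G -> H) (s : H -> G) (A : H -> Prop) :
  continuous opG opH p -> (forall x y, p (mulG x y) = mulH (p x) (p y)) ->
  (forall (K : Type) (d : K -> K -> R) (f : K -> H), continuous (metric_open d) opH f ->
    continuous (metric_open d) opG (fun k => s (f k))) ->
  (forall y, p (s y) = y) ->
  haar_meager opH mulH A -> haar_meager opG mulG (fun x => A (p x)).
Proof.
  intros cp hp cs ps (B & bB & HB & K & d & f & md & cK & iK & cf & Hm).
  exists (fun x => B (p x)). split; [apply borel_preimage with (1 := cp) (2 := bB) |].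
  split; [auto |].
  exists K, d, (fun k => s (f k)). do 3 (split; [assumption |]). split.
  - apply cs, cf.
  - intros g h. apply meager_subset with (2 := Hm (p g) (p h)).
    intros k (b & Hb & E). exists (p b). split; [assumption |].
    rewrite <- (ps (f k)), E, !hp. reflexivity.
Qed.

Lemma two_sided_translate_continuous {G : Type} (op : (G -> Prop) -> Prop)
  (mul : G -> G -> G) (inv : G -> G) (one : G) (K : Type) (d : K -> K -> R) (f : K -> G)
  (g h : G) :
  polish_group op mul inv one -> continuous (metric_open d) op f ->
  continuous (metric_open d) op (fun k => mul (mul g (f k)) h).
Proof.
  intros (_ & _ & _ & _ & cm & _) cf.
  apply (continuous_comp (f := fun k => (mul g (f k), h))
    (g := fun p => mul (fst p) (snd p)) (opY := prod_open op op)); [| exact cm].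
  apply continuous_pair; [| apply continuous_const].
  apply (continuous_comp (f := fun k => (g, f k))
    (g := fun p => mul (fst p) (snd p)) (opY := prod_open op op)); [| exact cm].
  apply continuous_pair; [apply continuous_const | exact cf].
Qed.

(** Turns the preimage of a translate into a preimage of [B] itself under a continuous map, to which
    the Baire property for Borel preimages applies. *)
Lemma in_translate_iff {G : Type} (op : (G -> Prop) -> Prop) (mul : G -> G -> G)
  (inv : G -> G) (one : G) (B : G -> Prop) (g h x : G) :
  polish_group op mul inv one ->
  (exists b, B b /\ x = mul (mul g b) h) <-> B (mul (mul (inv g) x) (inv h)).
Proof.
  intros (_ & assoc & unit & invs & _). split.
  - intros (b & Hb & ->).
    replace (mul (mul (inv g) (mul (mul g b) h)) (inv h)) with b; [assumption |].
    rewrite !assoc, (proj1 (invs g)), (proj1 (unit b)), <- assoc, (proj2 (invs h)).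
    symmetry. apply unit.
  - intros Hb. eexists. split; [exact Hb |].
    rewrite !assoc, (proj2 (invs g)), (proj1 (unit x)), <- assoc, (proj1 (invs h)).
    symmetry. apply unit.
Qed.

(* A translate of [B1] has nonmeager preimage in [K], hence comeager in some open set; the
   witness for [B2] is then sought on the closure of a small ball inside that open set. *)
Lemma haar_meager_borel_rectangle {G1 G2 : Type} (op1 : (G1 -> Prop) -> Prop)
  (mul1 : G1 -> G1 -> G1) (inv1 : G1 -> G1) (one1 : G1) (op2 : (G2 -> Prop) -> Prop)
  (mul2 : G2 -> G2 -> G2) (B1 : G1 -> Prop) (B2 : G2 -> Prop) (K : Type)
  (d : K -> K -> R) (f1 : K -> G1) (f2 : K -> G2) :
  polish_group op1 mul1 inv1 one1 ->
  borel op1 B1 -> borel op2 B2 ->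
  is_metric d -> Defs.compact (metric_open d) -> inhabited K ->
  continuous (metric_open d) op1 f1 -> continuous (metric_open d) op2 f2 ->
  (forall g1 h1 g2 h2, meager (metric_open d) (fun k =>
    (exists b, B1 b /\ f1 k = mul1 (mul1 g1 b) h1) /\
    (exists b, B2 b /\ f2 k = mul2 (mul2 g2 b) h2))) ->
  haar_meager op1 mul1 B1 \/ haar_meager op2 mul2 B2.
Proof.
  intros HG1 bB1 bB2 md cK iK cf1 cf2 Hm.
  destruct (classic (haar_meager op1 mul1 B1)) as [Hyes | Hno]; [left; assumption | right].
  assert (Hgh : exists g h,
    ~ meager (metric_open d) (fun k => exists b, B1 b /\ f1 k = mul1 (mul1 g b) h)).
  { apply NNPP. intros Hn. apply Hno. exists B1. split; [assumption |].
    split; [auto |]. exists K, d, f1. split; [assumption |].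
    do 3 (split; [assumption |]). intros g h. apply NNPP. eauto. }
  destruct Hgh as (g1 & h1 & Hgh).
  destruct (@baire_property_nonmeager _ d
    (fun k => exists b, B1 b /\ f1 k = mul1 (mul1 g1 b) h1)) as (U & oU & [x Ux] & HU).
  - replace (fun k => _) with (fun k => B1 (mul1 (mul1 (inv1 g1) (f1 k)) (inv1 h1))).
    + apply baire_property_borel_preimage with op1; [| assumption].
      eapply two_sided_translate_continuous; eassumption.
    + apply pred_ext. intros k. symmetry. apply in_translate_iff with (1 := HG1).
  - assumption.
  - destruct (oU x Ux) as [r [Hr HrU]].
    (* Half the radius keeps the closure of the ball inside [U]. *)
    pose (V := fun y => d x y < r / 2).
    assert (oV : metric_open d V) by apply metric_open_ball, md.
    assert (HVU : forall y, closure d V y -> U y).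
    { intros y Hy. apply HrU. destruct (Hy (r / 2)) as [v [Vv Hv]]; [lra |].
      unfold V in Vv. destruct md as (_ & _ & sym & tri).
      specialize (tri x v y). rewrite (sym v y) in tri. lra. }
    exists B2. split; [assumption |]. split; [auto |].
    exists {y | closure d V y}, (sub_dist d (closure d V)), (fun y => f2 (proj1_sig y)).
    split; [apply sub_dist_metric, md |].
    split; [apply compact_closed_subspace; [assumption | assumption |
      apply closure_compl_open, md] |].
    split.
    { constructor. exists x. intros e He. exists x. unfold V.
      rewrite metric_refl by assumption. split; lra. }
    split.
    { apply continuous_comp with (2 := cf2). apply continuous_proj1_sig. }
    intros g2 h2.
    (* On the closure, either [f1] misses the chosen translate of [B1], which is meager inside [U],
       or both coordinates hit their translates, which is meager by hypothesis. *)
    apply meager_subset with (2 := meager_closure_subspace md oV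
      (meager_union HU (Hm g1 h1 g2 h2))).
    intros [y Hy] H. cbn in *. specialize (HVU y Hy).
    destruct (classic (exists b, B1 b /\ f1 y = mul1 (mul1 g1 b) h1)); tauto.
Qed.

Theorem theorem4p1
  (G1 : Type) (op1 : (G1 -> Prop) -> Prop) (mul1 : G1 -> G1 -> G1) (inv1 : G1 -> G1) (one1 : G1)
  (G2 : Type) (op2 : (G2 -> Prop) -> Prop) (mul2 : G2 -> G2 -> G2) (inv2 : G2 -> G2) (one2 : G2)
  (HG1 : polish_group op1 mul1 inv1 one1)
  (HG2 : polish_group op2 mul2 inv2 one2)
  (A1 : G1 -> Prop) (A2 : G2 -> Prop)
  (HA1 : analytic op1 A1) (HA2 : analytic op2 A2) :
  (~ haar_meager op1 mul1 A1 /\ ~ haar_meager op2 mul2 A2) <->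
  ~ haar_meager (prod_open op1 op2) (prod_mul mul1 mul2) (setX A1 A2).
Proof.
  assert (T1 : op1 (fun _ => True)).
  { destruct HG1 as (((d & _ & _ & E) & _) & _). apply E, metric_open_univ. }
  assert (T2 : op2 (fun _ => True)).
  { destruct HG2 as (((d & _ & _ & E) & _) & _). apply E, metric_open_univ. }
  split.
  - intros [H1 H2] (B & bB & HB & K & d & f & md & cK & iK & cf & Hm).
    destruct (analytic_souslin_rect_sep T1 T2 (C := fun p => ~ B p) HA1 HA2)
      as (B1 & B2 & bB1 & bB2 & I1 & I2 & Hsep).
    + destruct HG1 as (((d1 & m1 & _ & E1) & _) & _).
      destruct HG2 as (((d2 & m2 & _ & E2) & _) & _).
      apply borel_souslin with (max_dist d1 d2).
      * apply max_dist_metric; assumption.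
      * intros V. apply prod_open_max_dist; assumption.
      * apply borel_compl, bB.
    + intros x y Hx Hy Hn. apply Hn, HB. split; assumption.
    + destruct (@haar_meager_borel_rectangle G1 G2 op1 mul1 inv1 one1 op2 mul2 B1 B2 K d
        (fun k => fst (f k)) (fun k => snd (f k))) as [H | H]; try assumption.
      * apply continuous_comp with (1 := cf). apply continuous_fst, T2.
      * apply continuous_comp with (1 := cf). apply continuous_snd, T1.
      (* Multiplication is coordinatewise and the rectangle lies in [B], so a product of translates
         of [B1] and [B2] lies in one translate of [B]. *)
      * intros g1 h1 g2 h2. apply meager_subset with (2 := Hm (g1, g2) (h1, h2)).
        intros k [(b1 & Hb1 & E1) (b2 & Hb2 & E2)]. exists (b1, b2). split.
        { apply NNPP. intros Hn. exact (Hsep b1 b2 Hb1 Hb2 Hn). }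
        unfold prod_mul. cbn. rewrite <- E1, <- E2. apply surjective_pairing.
      * apply H1. apply haar_meager_subset with B1; assumption.
      * apply H2. apply haar_meager_subset with B2; assumption.
  - intros H. split; intros HA; apply H.
    (* The product is enlarged to a full cylinder over [A1], a preimage under [fst], with a constant
       second coordinate giving the section. *)
    + apply haar_meager_subset with (fun p => A1 (fst p)); [intros p Hp; apply Hp |].
      apply haar_meager_preimage with (opH := op1) (mulH := mul1) (s := fun x => (x, one2));
        try assumption; try reflexivity.
      * apply continuous_fst, T2.
      * intros K d f cf. apply continuous_pair; [assumption | apply continuous_const].
    + apply haar_meager_subset with (fun p => A2 (snd p)); [intros p Hp; apply Hp |].
      apply haar_meager_preimage with (opH := op2) (mulH := mul2) (s := fun x => (one1, x));
        try assumption; try reflexivity.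
      * apply continuous_snd, T1.
      * intros K d f cf. apply continuous_pair; [apply continuous_const | assumption].
Qed.
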